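(* Let $X$ be a Tychonoff space and let $\lambda\in\{F(X),MC(X),K(X),SC(X),CC(X),PS(X),RC(X)\}$. Then the $\lambda$-open topology on $C(X)$ is the same as the topology of uniform convergence on elements of the family $\lambda$, that is, $C_\lambda(X)=C_{\lambda,u}(X)$. Moreover, $C_\lambda(X)$ is a Hausdorff locally convex topological vector space.
   Context: $C(X)$ is the set of all continuous real-valued functions on $X$ with pointwise operations. For a family $\lambda$ of non-empty subsets of $X$, $C_\lambda(X)$ is $C(X)$ with the $\lambda$-open topology, whose subbase consists of all sets $[F,U]=\{f\in C(X): f(F)\subseteq U\}$ with $F\in\lambda$, $U\subseteq\mathbb{R}$ open; $C_{\lambda,u}(X)$ is $C(X)$ with the topology in which the sets $\{g\in C(X): \sup_{x\in F}|f(x)-g(x)|<\varepsilon\}$, $F\in\lambda$, $\varepsilon>0$, are the basic neighborhoods of $f$. A subset $A\subseteq X$ is a $C$-compact subset of $X$ if $f(A)$ is compact in $\mathbb{R}$ for every $f\in C(X)$. The following denote collections of non-empty subsets of $X$: $F(X)$ all finite subsets; $MC(X)$ all metrizable compact subsets; $K(X)$ all compact subsets; $SC(X)$ all sequentially compact subsets; $CC(X)$ all countably compact subsets; $PS(X)$ all pseudocompact subsets; $RC(X)$ all $C$-compact subsets of $X$. (Except for $C$-compactness, the properties refer to the subspace topology.) *)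

(* Defs.v *)
From HB Require Import structures.
From mathcomp Require Import all_boot all_order all_algebra.
From mathcomp Require Import all_classical all_reals all_analysis.
Import Order.TTheory GRing.Theory Num.Theory.
Import numFieldTopology.Exports numFieldNormedType.Exports.

Set Implicit Arguments.
Unset Strict Implicit.
Unset Printing Implicit Defensive.

Local Open Scope classical_set_scope.
Local Open Scope ring_scope.

(* The real vector space C(X), carried by the library type continuousType X R. *)
Section pointwise_operations.
Context (X : topologicalType) (R : realType).
Local Notation CX := (continuousType X R).
Implicit Types (f g h : CX) (a b : R).

Let addC_cts f g : continuous (fun x => f x + g x : R).
Proof. by move=> x; apply: cvgD; exact: cts_fun. Qed.

Let oppC_cts f : continuous (fun x => - f x : R).
Proof. by move=> x; apply: cvgN; exact: cts_fun. Qed.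

Let scaleC_cts a f : continuous (fun x => a * f x : R).
Proof. by move=> x; apply: cvgM; [exact: cvg_cst|exact: cts_fun]. Qed.

Definition cts_zero : CX := cst 0 : X -> R.
Definition cts_add f g : CX := mkcts (@addC_cts f g).
Definition cts_opp f : CX := mkcts (@oppC_cts f).
Definition cts_scale a f : CX := mkcts (@scaleC_cts a f).

Let addCA : associative cts_add.
Proof. by move=> f g h; apply/continuousEP => x; exact: addrA. Qed.

Let addCC : commutative cts_add.
Proof. by move=> f g; apply/continuousEP => x; exact: addrC. Qed.

Let add0C : left_id cts_zero cts_add.
Proof. by move=> f; apply/continuousEP => x; exact: add0r. Qed.

Let addNC : left_inverse cts_zero cts_opp cts_add.
Proof. by move=> f; apply/continuousEP => x; exact: addNr. Qed.

HB.instance Definition _ :=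
  GRing.isZmodule.Build CX addCA addCC add0C addNC.

Let scaleCA a b f : cts_scale a (cts_scale b f) = cts_scale (a * b) f.
Proof. by apply/continuousEP => x; exact: mulrA. Qed.

Let scale1C : left_id 1 cts_scale.
Proof. by move=> f; apply/continuousEP => x; exact: mul1r. Qed.

Let scaleCDr : right_distributive cts_scale +%R.
Proof. by move=> a f g; apply/continuousEP => x; exact: mulrDr. Qed.

Let scaleCDl f : {morph cts_scale^~ f : a b / a + b}.
Proof. by move=> a b; apply/continuousEP => x; exact: mulrDl. Qed.

HB.instance Definition _ :=
  GRing.Zmodule_isLmodule.Build R CX scaleCA scale1C scaleCDr scaleCDl.

End pointwise_operations.

(* C_lambda(X).  lam is a phantom parameter selecting the topology. *)
Definition set_open (X : topologicalType) (R : realType) (lam : set (set X))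
  : Type := continuousType X R.
Arguments set_open {X} R lam.

Section set_open_topology.
Context (X : topologicalType) (R : realType) (lam : set (set X)).

HB.instance Definition _ :=
  GRing.Lmodule.copy (set_open R lam) (continuousType X R).

Definition set_open_subbase (FU : set X * set R) : set (set_open R lam) :=
  [set f : continuousType X R | f @` FU.1 `<=` FU.2].

HB.instance Definition _ := isSubBaseTopological.Build (set_open R lam)
  [set FU : set X * set R | lam FU.1 /\ open FU.2] set_open_subbase.

End set_open_topology.

(* C_{lambda,u}(X), given by its open sets. *)
Section uniform_topology.
Context (X : topologicalType) (R : realType).
Local Notation CX := (continuousType X R).

(* The supremum is taken in \bar R, as f - g need not be bounded on F. *)
Definition sup_ball (F : set X) (f : CX) (e : R) : set CX :=
  [set g : CX | (ereal_sup [set `|f x - g x|%:E | x in F] < e%:E)%E].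

(* The sets which contain a basic neighborhood of each of their points.  The
   first disjunct only matters when lam is empty, which, for the families
   below, happens exactly when X is empty. *)
Definition uniform_open (lam : set (set X)) : set (set CX) :=
  [set W | W = setT \/
    forall f, W f ->
      exists F (e : R), [/\ lam F, 0 < e & sup_ball F f e `<=` W]].

End uniform_topology.

Section topological_properties.
Context (R : realType) (T : topologicalType).

Definition tychonoff_space : Prop :=
  accessible_space T /\ completely_regular_space T.

Definition metrizable : Prop :=
  exists d : T -> T -> R,
    [/\ forall x y, 0 <= d x y,
        forall x y, d x y = 0 <-> x = y,
        forall x y, d x y = d y x,
        forall x y z, d x z <= d x y + d y z &
        forall x (W : set T), nbhs x W <->
          exists2 e : R, 0 < e & [set y | d x y < e] `<=` W].

Definition sequentially_compact : Prop :=
  forall u : nat -> T, exists (phi : nat -> nat) (l : T),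
    {homo phi : m n / (m < n)%N} /\ (u \o phi) @ \oo --> l.

Definition countably_compact : Prop :=
  forall U : nat -> set T, (forall n, open (U n)) ->
    \bigcup_n U n = setT -> exists N, \bigcup_(n < N) U n = setT.

Definition pseudocompact : Prop :=
  forall f : T -> R, continuous f -> exists M, forall x, `|f x| <= M.

End topological_properties.

Section families.
Context (R : realType) (X : topologicalType).

Definition C_compact (A : set X) : Prop :=
  forall f : X -> R, continuous f -> compact (f @` A).

Definition F_family : set (set X) := [set A | A !=set0 /\ finite_set A].
Definition MC_family : set (set X) :=
  [set A | [/\ A !=set0, compact A & metrizable R (set_type A)]].
Definition K_family : set (set X) := [set A | A !=set0 /\ compact A].
Definition SC_family : set (set X) :=
  [set A | A !=set0 /\ sequentially_compact (set_type A)].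
Definition CC_family : set (set X) :=
  [set A | A !=set0 /\ countably_compact (set_type A)].
Definition PS_family : set (set X) :=
  [set A | A !=set0 /\ pseudocompact R (set_type A)].
Definition RC_family : set (set X) := [set A | A !=set0 /\ C_compact A].

End families.
Arguments F_family X : clear implicits.
Arguments MC_family R X : clear implicits.
Arguments K_family X : clear implicits.
Arguments SC_family X : clear implicits.
Arguments CC_family X : clear implicits.
Arguments PS_family R X : clear implicits.
Arguments RC_family R X : clear implicits.

(* The requirements of the library's factory PreTopologicalLmod_isTvs. *)
Definition locally_convex_tvs (R : realType) (E : preTopologicalLmodType R) :=
  [/\ continuous (fun z : E * E => z.1 + z.2),
      continuous (fun z : R^o * E => z.1 *: z.2) &
      exists2 B : set_system E, (forall b, b \in B -> convex_set b) & basis B].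

(* Main.v *)
Require Import Defs.
From mathcomp Require Import all_boot all_order all_algebra.
From mathcomp Require Import all_classical all_reals all_analysis.
From mathcomp Require Import ring lra.
Import Order.TTheory GRing.Theory Num.Theory.
Import numFieldTopology.Exports numFieldNormedType.Exports.

(** Two features of the family [lam] make the two topologies agree.

    (1) Every [F] in [lam] is C-compact.  If [f] maps [F] into an open set [U],
    then the compact set [f(F)] stays at a positive distance [e] from the
    complement of [U], so every [g] that is uniformly [e]-close to [f] on [F]
    still maps [F] into [U] ([sup_ball_sub_subbase]).  Hence subbasic open sets
    are open for uniform convergence, finite intersections being handled by
    the stability of [lam] under finite unions.

    (2) Every [F] in [lam] can be cut, along a given [f] in [C(X)], into pieces
    of [lam] on which [f] is almost constant: for [a < b] some piece contains
    all points of [F] where [a < f < b], and [a <= f <= b] holds on it.  Cover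
    the compact set [f(F)] by finitely many open intervals of centre [c] and
    radius [d].  The conditions that [g] map the piece of [c] into the interval
    of centre [c] and radius [2d] define finitely many subbasic neighbourhoods
    of [f], and any [g] in all of them is uniformly [3d]-close to [f] on [F]
    ([nbhs_sup_ball]).

    These requirements, with the presence of the singletons, are collected in
    [slice_stable]; [set_open_slice_stable] derives the whole statement from
    them.  Hausdorffness comes from the singletons, continuity of the vector
    space operations from the usual estimates for uniform convergence on sets
    where functions are bounded, and local convexity from the convexity of
    uniform balls.

    It remains to see that the seven families are slice stable.  Finite,
    compact, sequentially compact and countably compact sets are pseudocompact,
    hence C-compact, and their closed slices, where [a <= f <= b], are of the
    same kind.  Three families need an idea.

    - C-compact sets: the slice is again C-compact because a limit value [t] of
      [g] on the slice is attained at a zero of [dist(f, [a, b]) + |g - t|], a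
      continuous function, which maps [F] onto a closed set
      ([C_compact_slice_stable]).

    - Pseudocompact sets: closed subsets of a pseudocompact space may fail to be
      pseudocompact, so the piece is the closure in [F] of the open slice,
      where [a < f < b].  It is pseudocompact because in a completely regular
      pseudocompact space the closures of a decreasing sequence of nonempty
      open sets have a common point ([pseudocompact_decreasing_open]).

    - Metrizable compact sets: the point is that the union of two of them is
      metrizable.  For compact subsets of a Hausdorff space, metrizability is
      equivalent to the existence of a countable network
      ([compact_metrizableP]), and networks are trivially inherited by subsets
      and by finite unions. *)

Set Implicit Arguments.
Unset Strict Implicit.
Unset Printing Implicit Defensive.

Local Open Scope classical_set_scope.
Local Open Scope convex_scope.
Local Open Scope ring_scope.

(** * Two facts on small positive reals *)

Section RealFacts.
Context (R : realType).

Lemma near_right0_ex (P : R -> Prop) :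
  (\forall e \near 0^'+, P e) -> exists2 e, 0 < e & P e.
Proof.
move=> nP; have [e []] : exists e, 0 < e /\ P e; last by exists e.
apply: (@filter_ex _ (0 : R)^'+); near=> e; split; near: e => //.
exact: nbhs_right_gt.
Unshelve. all: by end_near. Qed.

Lemma natSinv_lt (e : R) : 0 < e -> exists n, n.+1%:R^-1 < e.
Proof.
move=> e0; exists (Num.truncn e^-1).
by rewrite -[ltRHS]invrK ltf_pV2 ?posrE ?invr_gt0// truncnS_gt.
Qed.

End RealFacts.

(** * Subsets as spaces in their own right *)

Section Subtype.
Context (X : topologicalType) (A : set X).

Lemma nbhs_set_type (x : A) (W : set A) :
  nbhs x W <-> exists2 Q : set X, nbhs (\val x) Q & \val @^-1` Q `<=` W.
Proof.
split=> [[_ [[Q oQ <-] Qx] QW]|[Q]].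
  by exists Q => //; apply: open_nbhs_nbhs.
rewrite nbhsE => -[V [oV Vx] VQ QW].
exists (\val @^-1` V); split=> [||y /VQ]; [by exists V|exact: Vx|exact: QW].
Qed.

Lemma open_set_type (W : set A) :
  open W <-> exists2 Q : set X, open Q & W = \val @^-1` Q.
Proof. by split=> [[Q oQ <-]|[Q oQ ->]]; exists Q. Qed.

Lemma val_continuous : continuous (\val : A -> X).
Proof. by move=> x W Wx; apply/nbhs_set_type; exists W. Qed.

(** Near-coverings transfer directly: a property of the points of the subspace
    is turned into one of points [x] of the ambient space by quantifying over
    the (unique) subspace point lying over [x]. *)
Lemma compact_set_type : compact A -> compact [set: A].
Proof.
move=> /compact_near_coveringP cA; apply/compact_near_coveringP.
move=> I F P FF PF.
have : \forall i \near F, A `<=` [set x | forall y : A, \val y = x -> P i y].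
  apply: cA => x Ax.
  have [[U V] /= [/nbhs_set_type[Q Qx QU] FV] UVP] :=
    PF (exist _ x (mem_set Ax)) Logic.I.
  exists (Q, V) => //= -[y i]/= [Qy Vi] z zy; apply: (UVP (z, i)).
  by split => //; apply: QU; rewrite /= zy.
apply: filterS => i AP y _; apply: (AP (\val y)) => //.
exact/set_mem/(valP y).
Qed.

Lemma hausdorff_set_type : hausdorff_space X -> hausdorff_space A.
Proof.
move=> hX x y xy; apply/val_inj/hX => V W Vx Wy.
have [z [Vz Wz]] := xy _ _ (val_continuous Vx) (val_continuous Wy).
by exists (\val z).
Qed.

Lemma completely_regular_set_type (R : realType) :
  completely_regular_space X -> completely_regular_space A.
Proof.
move=> crX x B.
rewrite -openC => /open_set_type[Q oQ BO] Bx.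
have : uniform_separator [set \val x] (~` Q).
  apply: crX; first by rewrite closedC.
  move=> /= nQx; apply: Bx; apply: contrapT => nBx; apply: nQx.
  by move: nBx; rewrite -[~ _]/((~` B) x) BO.
move=> /(@uniform_separatorP _ R)[f [cf f01 f0 f1]].
apply/(@uniform_separatorP _ R); exists (f \o \val); split.
- by move=> y; apply: continuous_comp; [exact: val_continuous|exact: cf].
- by move=> _ [y _ <-]; apply: f01; exists (\val y).
- by move=> _ [_ -> <-]; apply: f0; exists (\val x).
- move=> _ [y By <-]; apply: f1; exists (\val y) => // Qy.
  have : (~` B) y by rewrite BO.
  exact.
Qed.

End Subtype.

(** * Comparison of compactness notions *)

Section Implications.
Context (R : realType).

Lemma compact_countably_compact (T : topologicalType) :
  compact [set: T] -> countably_compact T.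
Proof.
move=> /compact_near_coveringP cT U oU UT.
have : \forall N \near \oo, [set: T] `<=` [set x | (\bigcup_(n < N) U n) x].
  apply: cT => x _; have [n _ Unx] : (\bigcup_n U n) x by rewrite UT.
  exists (U n, [set N | (n < N)%N]).
    split => /=; last by exists n.+1.
    apply: open_nbhs_nbhs; split; [exact: oU|exact: Unx].
  by move=> [y N]/= [Uny nN]; exists n.
by move=> [N _ /(_ N (leqnn _)) NT]; exists N; rewrite -subTset.
Qed.

(** The near-covering form of compactness is applied to the filter of finite
    sequences ordered by inclusion: each point [x] is served by all sequences
    containing [x], hence some sequence serves every point. *)
Lemma compact_finite_subcover (T : topologicalType) (U : T -> set T) :
  compact [set: T] -> (forall x, nbhs x (U x)) ->
  exists s : seq T, forall y, exists2 x, x \in s & U x y.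
Proof.
move=> /compact_near_coveringP cT nU.
pose F : set_system (seq T) :=
  [set S | exists s0 : seq T, forall s : seq T, {subset s0 <= s} -> S s].
have FF : Filter F.
  split; first by exists [::].
    move=> A B [s sA] [t tB]; exists (s ++ t) => r str; split.
      by apply: sA => x xs; apply: str; rewrite mem_cat xs.
    by apply: tB => x xs; apply: str; rewrite mem_cat xs orbT.
  by move=> A B AB [s sA]; exists s => t /sA; exact: AB.
have [] := cT (seq T) F (fun s y => exists2 x, x \in s & U x y) FF.
  move=> x _; exists (U x, [set s : seq T | x \in s]).
    by split; [exact: nU|exists [:: x] => s /(_ x); apply; rewrite inE].
  by move=> [y s]/= [Uxy xs]; exists x.
by move=> s /(_ s (fun _ => id)) sT; exists s => y; exact: sT.
Qed.

(** If no [U 0, ..., U (n - 1)] covers, choose [u n] outside them; a limit [l]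
    of a subsequence lies in some [U k], which then contains [u n] for
    arbitrarily large [n], in particular for some [n > k]. *)
Lemma sequentially_countably_compact (T : topologicalType) :
  sequentially_compact T -> countably_compact T.
Proof.
move=> sT U oU UT; apply: contrapT => /forallNP noN.
have /choice[u uP] n : exists x, ~ (\bigcup_(i < n) U i) x.
  apply: contrapT => /forallNP covered; apply: (noN n); rewrite -subTset => x _.
  by apply: contrapT => /covered.
have [phi [l [phim ul]]] := sT u.
have [k _ Ukl] : (\bigcup_n U n) l by rewrite UT.
have : nbhs l (U k) by apply: open_nbhs_nbhs.
move=> /ul [N _ HN].
have phige n : (n <= phi n)%N.
  by elim: n => // n IH; rewrite (leq_ltn_trans IH)//; exact: phim.
have /= Uk := HN (maxn N k.+1) (leq_maxl _ _).
apply: (uP (phi (maxn N k.+1))); exists k => //=.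
by rewrite (leq_trans _ (phige _))// leq_maxr.
Qed.

Lemma countably_compact_pseudocompact (T : topologicalType) :
  countably_compact T -> pseudocompact R T.
Proof.
move=> cT f cf; have [| |N TN] := cT (fun n => [set x | `|f x| < n%:R]).
- move=> n.
  apply: (@open_comp _ _ (fun x => `|f x|) [set t | t < n%:R]) => [x _|].
    exact: (continuous_comp (cf x) (@norm_continuous _ _ _)).
  exact: open_lt.
- rewrite -subTset => x _; exists (Num.truncn `|f x|).+1 => //=.
  exact: truncnS_gt.
exists N%:R => x.
have [n /= nN fn] : (\bigcup_(n < N) [set x | `|f x| < n%:R]) x by rewrite TN.
by rewrite ltW// (lt_trans fn)// ltr_nat.
Qed.

(** A bounded image could only fail to be compact by missing one of its limit
    points [t], but then [1 / |f - t|] would be continuous and unbounded. *)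
Lemma pseudocompact_range (T : topologicalType) (f : T -> R) :
  pseudocompact R T -> continuous f -> compact (range f).
Proof.
move=> pT cf; have [M fM] := pT _ cf.
apply: (@subclosed_compact _ _ `[- M, M]%classic); last first.
- by move=> _ [x _ <-]; rewrite /= in_itv/= -ler_norml.
- exact: segment_compact.
move=> t ft; apply: contrapT => nft.
have nz x : `|f x - t| != 0.
  by rewrite normr_eq0 subr_eq0; apply/eqP => fxt; apply: nft; exists x.
have [|N gN] := pT (fun x => `|f x - t|^-1).
  move=> x; apply: cvgV => //.
  by apply: cvg_norm; apply: cvgB; [exact: cf|exact: cvg_cst].
have N1 : 0 < `|N| + 1 by rewrite ltr_wpDl.
have [|_ [[x _ <-]]] := ft (ball t (`|N| + 1)^-1).
  by apply: nbhsx_ballx; rewrite invr_gt0.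
rewrite /ball/= distrC => xt.
have := gN x; rewrite normfV normr_id => h.
have p0 : 0 < `|f x - t| by rewrite lt_def nz/=.
have : (`|N| + 1) < `|f x - t|^-1.
  by rewrite -[ltLHS]invrK ltf_pV2 ?posrE// invr_gt0.
have := ler_norm N; lra.
Qed.

Lemma image_set_type (X : topologicalType) (A : set X) (Y : Type) (f : X -> Y) :
  range (f \o \val : A -> Y) = f @` A.
Proof.
apply/seteqP; split=> [_ [x _ <-]|_ [x Ax <-]].
  by exists (\val x) => //; exact/set_mem/(valP x).
by exists (exist _ x (mem_set Ax)).
Qed.

Lemma pseudocompact_C_compact (X : topologicalType) (A : set X) :
  pseudocompact R A -> C_compact R A.
Proof.
move=> pA f cf; rewrite -image_set_type; apply: pseudocompact_range => // y.
by apply: continuous_comp; [exact: val_continuous|exact: cf].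
Qed.

End Implications.

(** * Relative compactness notions in terms of the ambient space *)

Section Characterizations.
Context (X : topologicalType).

Lemma sequentially_compactP (A : set X) :
  sequentially_compact A <->
  forall u : nat -> X, (forall n, A (u n)) -> exists (phi : nat -> nat) l,
    [/\ {homo phi : m n / (m < n)%N}, A l & (u \o phi) @ \oo --> l].
Proof.
split=> [sA u Au|sA u].
  have [phi [l [phim ul]]] := sA (fun n => exist _ (u n) (mem_set (Au n))).
  exists phi, (\val l); split => //; first exact/set_mem/(valP l).
  by move=> W /val_continuous/ul.
have [|phi [l [phim Al ul]]] := sA (\val \o u).
  by move=> n; exact/set_mem/(valP (u n)).
exists phi, (exist _ l (mem_set Al)); split => // W /nbhs_set_type[Q Ql QW].
by apply: (@filterS _ \oo _ _ _ _ (ul Q Ql)) => n Qn; exact: QW.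
Qed.

Lemma countably_compactP (A : set X) :
  countably_compact A <->
  forall U : nat -> set X, (forall n, open (U n)) -> A `<=` \bigcup_n U n ->
    exists N, A `<=` \bigcup_(n < N) U n.
Proof.
split=> [cA U oU AU|cA U oU AU].
  have [n||N NT] := cA (fun n => \val @^-1` U n).
  - by apply/open_set_type; exists (U n).
  - rewrite -subTset => x _; have [|n _ Un] := AU (\val x); last by exists n.
    exact/set_mem/(valP x).
  exists N => x Ax; pose y : A := exist _ x (mem_set Ax).
  suff [n nN Un] : (\bigcup_(n < N) (\val @^-1` U n : set A)) y by exists n.
  by rewrite NT.
have /choice[V oV] n : exists V, open V /\ U n = \val @^-1` V.
  by have /open_set_type[V] := oU n; exists V.
have [n|x Ax|N AN] := cA V; first by have [] := oV n.
  have [n _] : (\bigcup_n U n) (exist _ x (mem_set Ax)) by rewrite AU.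
  by have [_ ->] := oV n; exists n.
exists N; rewrite -subTset => x _.
have [|n nN Vn] := AN (\val x); first exact/set_mem/(valP x).
by exists n => //; have [_ ->] := oV n.
Qed.

Definition set_type_incl (A B : set X) (AB : A `<=` B) (x : A) : B :=
  exist _ (\val x) (mem_set (AB _ (set_mem (valP x)))).

Lemma set_type_incl_continuous (A B : set X) (AB : A `<=` B) :
  continuous (set_type_incl AB).
Proof.
move=> x W /nbhs_set_type[Q Qx QW]; apply/nbhs_set_type; exists Q => //.
by move=> y Qy; exact: QW.
Qed.

End Characterizations.

(** * Families that can be sliced along continuous functions *)

Section Stable.
Context (X : topologicalType) (R : realType).

(** The properties of a family of sets that force its set-open topology on
    [C(X)] to be that of uniform convergence.  The piece [B] is only sandwiched
    between the open and the closed slice of [A], because neither of these two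
    slices of a pseudocompact set need be pseudocompact. *)
Definition slice_stable (P : set X -> Prop) := [/\
  forall A, P A -> C_compact R A,
  forall A B, P A -> P B -> P (A `|` B),
  forall x, P [set x] &
  forall A (f : X -> R) a b, P A -> continuous f ->
    exists B, [/\ A `&` f @^-1` `]a, b[ `<=` B, B `<=` f @^-1` `[a, b] & P B]].

Lemma closed_slice (f : X -> R) a b : continuous f -> closed (f @^-1` `[a, b]).
Proof.
by move=> cf; apply: preimage_closed => [x _|]; [exact: cf|exact: itv_closed].
Qed.

Lemma slice_exists (P : set X -> Prop) A (f : X -> R) a b :
  P (A `&` f @^-1` `[a, b]) ->
  exists B, [/\ A `&` f @^-1` `]a, b[ `<=` B, B `<=` f @^-1` `[a, b] & P B].
Proof.
move=> PA; exists (A `&` f @^-1` `[a, b]); split => // x [].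
by move=> Ax /=; rewrite !in_itv/= => /andP[/ltW -> /ltW ->].
Qed.

Lemma compact_C_compact (A : set X) : compact A -> C_compact R A.
Proof.
move=> cA f cf; apply: continuous_compact => //.
exact: continuous_subspaceT.
Qed.

Lemma finite_set_slice_stable : slice_stable finite_set.
Proof.
split=> [A /finite_compact/compact_C_compact//|A B fA fB|x|A f a b fA _].
- by rewrite finite_setU.
- exact: finite_set1.
- by apply: slice_exists; apply: finite_setIl.
Qed.

Lemma compact_slice_stable : slice_stable compact.
Proof.
split=> [A /compact_C_compact//|A B|x|A f a b cA cf].
- exact: compactU.
- exact: compact_set1.
- by apply: slice_exists; apply: compact_closedI => //; exact: closed_slice.
Qed.

(** [h = dist(f, [a, b]) + |g - t|], up to a factor 2 in the first term, is
    continuous on [X] and has infimum 0 on [A] when [t] is a limit of values of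
    [g] on the slice; since [h(A)] is closed, [h] vanishes at a point of [A],
    which lies in the slice and where [g] takes the value [t]. *)
Lemma C_compact_slice_stable : slice_stable (@C_compact R X).
Proof.
split=> [//|A B cA cB f cf|x f cf|A f a b cA cf].
- by rewrite image_setU; apply: compactU; [exact: cA|exact: cB].
- by rewrite image_set1; exact: compact_set1.
apply: slice_exists => g cg; apply: subclosed_compact (cA g cg) _; last first.
  by apply: image_subset; exact: subIsetl.
move=> t gt.
have ab : a <= b.
  have [_ [[x [_ +] _] _]] := gt _ (nbhsx_ballx t 1 ltr01).
  by rewrite /= in_itv/= => /andP[]; exact: le_trans.
pose h x := (`|f x - a| + `|f x - b| - (b - a)) + `|g x - t|.
have ch : continuous h.
  move=> x; apply: cvgD; last first.
    by apply: cvg_norm; apply: cvgB; [exact: cg|exact: cvg_cst].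
  apply: cvgB; last exact: cvg_cst.
  apply: cvgD; apply: cvg_norm; apply: cvgB; first [exact: cf|exact: cvg_cst].
have /compact_closed : compact (h @` A) by exact: cA.
move=> /(_ (@order_hausdorff _ R)) clh.
have [x Ax hx] : (h @` A) 0.
  apply: clh => W /nbhs_ballP[e /= e0 eW].
  have [_ [[x [Ax fx] <-] tx]] := gt _ (nbhsx_ballx t e e0).
  exists (h x); split; first by exists x.
  apply: eW; rewrite /ball/= sub0r normrN.
  have -> : h x = `|g x - t|.
    move: fx; rewrite /= in_itv/= => /andP[afx fxb].
    by rewrite /h ger0_norm ?subr_ge0// ler0_norm ?subr_le0//; ring.
  by rewrite normr_id distrC.
have n0 : 0 <= `|g x - t| by [].
have abs1 := ler_norm (f x - a); have abs2 := ler_norm (b - f x).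
have abs3 := ler_norm (a - f x); have abs4 := ler_norm (f x - b).
rewrite (distrC a) in abs3; rewrite (distrC b) in abs2.
have gxt : `|g x - t| = 0 by move: hx; rewrite /h; lra.
exists x; last by apply/eqP; rewrite -subr_eq0 -normr_eq0 gxt.
split => //; move: hx; rewrite /h gxt /= in_itv/= => hx.
apply/andP; split; lra.
Qed.

Lemma countably_compact_slice_stable :
  slice_stable (fun A : set X => countably_compact A).
Proof.
split=> [A cA|A B /countably_compactP cA /countably_compactP cB|x
  |A f a b /countably_compactP cA cf].
- exact/pseudocompact_C_compact/countably_compact_pseudocompact.
- apply/countably_compactP => U oU ABU.
  have [|N AN] := cA U oU; first by move=> x Ax; apply: ABU; left.
  have [|M BM] := cB U oU; first by move=> x Bx; apply: ABU; right.
  exists (maxn N M) => x [/AN|/BM] [n /= nN Un]; exists n => //=.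
    by rewrite leq_max nN.
  by rewrite leq_max nN orbT.
- exact/compact_countably_compact/compact_set_type/compact_set1.
(* A cover of the slice extends to one of A by the complement of the slice. *)
apply: slice_exists; apply/countably_compactP => U oU ABU.
have oC : open (~` (f @^-1` `[a, b])) by rewrite openC; exact: closed_slice.
have [n|x Ax|N AN] := cA (fun n => U n `|` ~` (f @^-1` `[a, b])).
- exact: openU.
- have [fx|nfx] := pselect ((f @^-1` `[a, b]) x); last first.
    by exists 0%N => //; right.
  by have [|n _ Un] := ABU x; [|exists n => //; left].
by exists N => x [Ax fx]; have [n nN [Un|//]] := AN x Ax; exists n.
Qed.

Lemma infinitely_often_subseq (P : set nat) :
  (forall n, exists m, (n <= m)%N /\ P m) ->
  exists2 phi : nat -> nat, {homo phi : m n / (m < n)%N} & forall n, P (phi n).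
Proof.
move=> /choice[g gP]; pose phi n := iter n (fun k => g k.+1) (g 0).
exists phi; last by case=> [|n]; [exact: (gP 0).2|exact: (gP _).2].
by apply: (homo_ltn ltn_trans) => n; exact: (gP (phi n).+1).1.
Qed.

(** For unions: a sequence in [A `|` B] either visits [A] infinitely often, or
    is eventually in [B]. *)
Lemma sequentially_compact_slice_stable :
  slice_stable (fun A : set X => sequentially_compact A).
Proof.
split=> [A cA|A B /sequentially_compactP cA /sequentially_compactP cB|x
  |A f a b /sequentially_compactP cA cf].
- apply: pseudocompact_C_compact; apply: countably_compact_pseudocompact.
  exact: sequentially_countably_compact.
- apply/sequentially_compactP => u ABu.
  have [/infinitely_often_subseq[psi psim Apsi]|] :=
      pselect (forall n, exists m, (n <= m)%N /\ A (u m)).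
    have [phi [l [phim Al ul]]] := cA (u \o psi) Apsi.
    exists (psi \o phi), l; split => //; last by left.
    by move=> m n mn; exact/psim/phim.
  move=> /existsNP[n /forallNP nA].
  have [|phi [l [phim Bl ul]]] := cB (fun m => u (n + m)%N).
    move=> m; have [Au|//] := ABu (n + m)%N.
    by exfalso; apply: (nA (n + m)%N); rewrite leq_addr.
  exists (fun m => n + phi m)%N, l; split => //; last by right.
  by move=> i j ij; rewrite ltn_add2l; exact: phim.
- apply/sequentially_compactP => u ux; exists id, x; split => //.
  have -> : u \o id = cst x by apply/funext => n /=; exact: ux.
  exact: cvg_cst.
apply: slice_exists; apply/sequentially_compactP => u Au.
have [n|phi [l [phim Al ul]]] := cA u; first by have [] := Au n.
exists phi, l; split => //; split => //.
apply: (closed_cvg _ (closed_slice cf) _ _ ul).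
by apply: nearW => n; have [] := Au (phi n).
Qed.

End Stable.

(** * Pseudocompact sets *)

Section Pseudocompact.
Context (R : realType).

(** Otherwise the [W n] are locally finite.  Choose [x n] in [W n] and a
    nonnegative continuous [phi n] that is 1 at [x n] and vanishes off [W n]:
    then the sum of the [k * phi k] is locally a finite sum, hence continuous,
    and it is at least [n] at [x n], against pseudocompactness. *)
Lemma pseudocompact_decreasing_open (T : topologicalType) (W : nat -> set T) :
  completely_regular_space T -> pseudocompact R T ->
  (forall n, open (W n)) -> (forall n, W n.+1 `<=` W n) ->
  (forall n, W n !=set0) -> exists y, forall n, closure (W n) y.
Proof.
move=> crT psT oW decW /choice[x Wx]; apply: contrapT => /forallNP noy.
have /choice[N HN] y : exists n, ~ closure (W n) y by exact/existsNP/noy.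
have decWle m n : (m <= n)%N -> W n `<=` W m.
  move=> /subnK <-; elim: (n - m)%N => // k IH; rewrite addSn.
  exact: subset_trans (decW _) IH.
have /choice[phi phiP] n : exists phi : T -> R, [/\ continuous phi,
    forall z, 0 <= phi z, phi (x n) = 1 & forall z, ~ W n z -> phi z = 0].
  have : uniform_separator [set x n] (~` W n).
    by apply: crT; [rewrite closedC|move=> /=; apply; exact: Wx].
  move=> /(@uniform_separatorP _ R)[f [cf f01 f0 f1]].
  exists (fun z => 1 - f z); split.
  - by move=> z; apply: cvgB; [exact: cvg_cst|exact: cf].
  - move=> z; have : `[0, 1]%classic (f z) by apply: f01; exists z.
    by rewrite /= in_itv/= subr_ge0 => /andP[].
  - have -> : f (x n) = 0 by apply: f0; exists (x n).
    by rewrite subr0.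
  - move=> z nWz; have -> : f z = 1 by apply: f1; exists z.
    by rewrite subrr.
(* The infinite sum Phi is encoded by cutting it, at each z, at an index N z
   beyond which all its terms vanish near z. *)
pose S M z := \sum_(0 <= k < M) k%:R * phi k z.
have Sstab M L z : (M <= L)%N -> ~ W M z -> S L z = S M z.
  move=> ML nWz; rewrite /S (big_cat_nat (leq0n M) ML)/=.
  rewrite [X in _ + X]big_nat [X in _ + X]big1 ?addr0//.
  move=> k /andP[Mk _]; have [_ _ _ ->] := phiP k; first by rewrite mulr0.
  by move=> /(decWle _ _ Mk).
pose Phi z := S (N z) z.
have nWN z : ~ W (N z) z by move=> /subset_closure; exact: HN.
have PhiE M z : ~ W M z -> Phi z = S M z.
  move=> nWz; rewrite -(Sstab M (maxn M (N z))) ?leq_maxl//.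
  by rewrite (Sstab (N z)) ?leq_maxr.
have cS M : continuous (S M).
  elim: M => [|M IH] y.
    rewrite [S 0%N](_ : _ = cst 0); first exact: cvg_cst.
    by apply/funext => z; rewrite /S big_geq.
  rewrite [S M.+1](_ : _ = fun z => S M z + M%:R * phi M z); last first.
    by apply/funext => z; rewrite /S big_nat_recr.
  apply: cvgD; first exact: IH.
  by apply: cvgM; [exact: cvg_cst|have [+ _ _ _] := phiP M; apply].
have cPhi : continuous Phi.
  move=> y; have cSy : S (N y) z @[z --> y] --> Phi y by exact: cS.
  apply: cvg_trans cSy; apply: near_eq_cvg.
  have : nbhs y (~` closure (W (N y))).
    apply: open_nbhs_nbhs; split; last exact: HN.
    exact/closed_openC/closed_closure.
  apply: filterS => z nz; rewrite (PhiE (N y))// => /subset_closure; exact: nz.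
have [M PhiM] := psT Phi cPhi.
pose n := (Num.truncn M).+1.
have nN : (n < N (x n))%N.
  rewrite ltnNge; apply/negP => /decWle/(_ _ (Wx n)); exact: nWN.
have : n%:R <= Phi (x n).
  rewrite /Phi /S (bigD1_seq n) ?mem_index_iota ?iota_uniq//=.
  have [_ _ -> _] := phiP n; rewrite mulr1 lerDl sumr_ge0// => k _.
  by rewrite mulr_ge0//; have [_ + _ _] := phiP k; apply.
have : M < n%:R := truncnS_gt M.
have := PhiM (x n); have := ler_norm (Phi (x n)); lra.
Qed.

(** If [g] were unbounded on the closure [B] of [A `&` U] in [A], it would be
    unbounded on the dense part [A `&` U], so that the open subsets
    [W n = {|g| > n}] of [A `&` U] would be nonempty.  A point in the closure of
    all the [W n] lies in [B], and [g] cannot be continuous there. *)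
Lemma pseudocompact_closure_open_slice (X : topologicalType) (A U : set X) :
  completely_regular_space X -> pseudocompact R A -> open U ->
  pseudocompact R (A `&` closure (A `&` U)).
Proof.
move=> crX psA oU g cg; set B := A `&` closure _ in g cg *.
have ngt (y : B) n : n%:R < `|g y| -> exists2 Q, nbhs (\val y) Q &
    forall z : B, Q (\val z) -> n%:R < `|g z|.
  move=> ny; apply/(nbhs_set_type y [set z | n%:R < `|g z|]).
  have := (@cvgr_gt R _ (nbhs y) _ (fun z => `|g z|) _ (cvg_norm (cg y)) _ ny).
  exact.
have nlt (y : B) n : `|g y| < n%:R -> exists2 Q, nbhs (\val y) Q &
    forall z : B, Q (\val z) -> `|g z| < n%:R.
  move=> ny; apply/(nbhs_set_type y [set z | `|g z| < n%:R]).
  have := (@cvgr_lt R _ (nbhs y) _ (fun z => `|g z|) _ (cvg_norm (cg y)) _ ny).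
  exact.
apply: contrapT => /forallNP unb.
pose W n : set A :=
  [set x | U (\val x) /\ exists2 y : B, \val y = \val x & n%:R < `|g y|].
have AB x : A x -> U x -> B x.
  by move=> Ax Ux; split => //; exact: subset_closure.
have [||n|n|n|y Wy] := @pseudocompact_decreasing_open A W.
- exact: completely_regular_set_type.
- exact: psA.
- rewrite openE => x [Ux [y yx /ngt[Q Qy QB]]].
  apply/nbhs_set_type; exists (Q `&` U).
    apply: filterI; first by rewrite -yx.
    by apply: open_nbhs_nbhs.
  move=> z [Qz Uz]; split => //.
  have Bz : B (\val z) by apply: AB => //; exact/set_mem/(valP z).
  by exists (exist _ (\val z) (mem_set Bz)) => //; exact: QB.
- move=> x [Ux [y yx ny]]; split => //; exists y => //.
  by rewrite (lt_trans _ ny)// ltr_nat.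
- have /existsNP[y /negP] := unb n%:R; rewrite -ltNge => /ngt[Q Qy QB].
  have [_ cly] := set_mem (valP y).
  have [z [[Az Uz] Qz]] := cly _ Qy.
  exists (exist _ z (mem_set Az)); split => //.
  by exists (exist _ z (mem_set (AB _ Az Uz))) => //; exact: QB.
have By : B (\val y).
  split; first exact/set_mem/(valP y).
  move=> Q Qy; have [z [[Uz _] Qz]] := Wy 0%N _ (val_continuous Qy).
  by exists (\val z); split => //; split => //; exact/set_mem/(valP z).
pose yB : B := exist _ (\val y) (mem_set By).
have [Q Qy QB] := nlt yB _ (truncnS_gt `|g yB|).
have [z [[Uz [w wz gw]] Qz]] := Wy (Num.truncn `|g yB|).+1 _
  (val_continuous (Qy : nbhs (\val y) Q)).
by have := QB w; rewrite wz => /(_ Qz) /(lt_trans gw); rewrite ltxx.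
Qed.

Lemma pseudocompact_slice_stable (X : topologicalType) :
  completely_regular_space X ->
  slice_stable R (fun A : set X => pseudocompact R A).
Proof.
move=> crX; split=> [A|A B psA psB f cf|x|A f a b psA cf].
- exact: pseudocompact_C_compact.
- have cincl (D : set X) (DAB : D `<=` A `|` B) :
    continuous (f \o set_type_incl DAB).
    move=> x; apply: continuous_comp; last exact: cf.
    exact: set_type_incl_continuous.
  have [M fM] := psA _ (cincl _ (@subsetUl _ A B)).
  have [N fN] := psB _ (cincl _ (@subsetUr _ A B)).
  exists (Num.max M N) => x; rewrite le_max; have /set_mem[Ax|Bx] := valP x.
    pose y : A := exist _ (\val x) (mem_set Ax).
    have -> : x = set_type_incl (@subsetUl _ A B) y by exact: val_inj.
    by apply/orP; left; exact: fM.
  pose y : B := exist _ (\val x) (mem_set Bx).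
  have -> : x = set_type_incl (@subsetUr _ A B) y by exact: val_inj.
  by apply/orP; right; exact: fN.
- apply: countably_compact_pseudocompact; apply: compact_countably_compact.
  exact/compact_set_type/compact_set1.
have oU : open (f @^-1` `]a, b[).
  by apply: open_comp => [x _|]; [exact: cf|exact: itv_open].
exists (A `&` closure (A `&` f @^-1` `]a, b[)); split.
- by move=> x AUx; split; [case: AUx|exact: subset_closure].
- have /closure_id -> := @closed_slice X R f a b cf.
  move=> x [_ clx]; apply: (closureS _ clx) => y [_] /=.
  by rewrite !in_itv/= => /andP[/ltW -> /ltW ->].
- exact: pseudocompact_closure_open_slice.
Qed.

End Pseudocompact.

(** * Metrizable compact sets and countable networks *)

Section Network.
Context (R : realType).

(** The metric is [d x y = sup_n |g n x - g n y| / (n + 1)].  It separates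
    points because the [g n] do.  The weights tend to 0, so only finitely many
    [n] matter up to a given precision and [d]-balls are neighbourhoods.
    Conversely, compactness makes [d x] bounded below by a positive constant
    off any neighbourhood of [x]. *)
Lemma separating_sequence_metrizable (T : topologicalType) (g : nat -> T -> R) :
  compact [set: T] -> (forall n, continuous (g n)) ->
  (forall n x, 0 <= g n x <= 1) ->
  (forall x y, x <> y -> exists n, g n x != g n y) -> metrizable R T.
Proof.
move=> cT cg g01 gsep.
pose t n x y : R := `|g n x - g n y| / n.+1%:R.
have t_ge0 n x y : 0 <= t n x y by rewrite divr_ge0.
have t_le n x y : t n x y <= n.+1%:R^-1.
  rewrite ler_piMl ?invr_ge0// ler_norml.
  have := g01 n x; have := g01 n y; lra.
have txx n x : t n x x = 0 by rewrite /t subrr normr0 mul0r.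
have ct n x : continuous (t n x).
  move=> y; apply: cvgM; last exact: cvg_cst.
  by apply: cvg_norm; apply: cvgB; [exact: cvg_cst|exact: cg].
pose d x y : R := sup (range (fun n => t n x y)).
have le_d n x y : t n x y <= d x y.
  apply: ub_le_sup; last by exists n.
  exists 1 => _ [k _ <-]; rewrite (le_trans (t_le _ _ _))// invf_le1//.
  by rewrite ler1n.
have d_le x y r : (forall n, t n x y <= r) -> d x y <= r.
  move=> tr; apply: ge_sup => [|_ [n _ <-]//].
  by exists (t 0%N x y); exists 0%N.
have t_gt0 x y : x <> y -> exists n, 0 < t n x y.
  move=> /gsep[n gn]; exists n.
  by rewrite divr_gt0// normr_gt0 subr_eq0.
exists d; split.
- by move=> x y; exact: le_trans (le_d 0%N x y).
- move=> x y; split=> [dxy|->].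
    apply: contrapT => /t_gt0[n]; rewrite ltNge => /negP; apply.
    by rewrite -dxy.
  apply/eqP; rewrite eq_le (le_trans _ (le_d 0%N y y))// andbT.
  by apply: d_le => n; rewrite txx.
- move=> x y; rewrite /d.
  suff -> : (fun n => t n x y) = (fun n => t n y x) by [].
  by apply/funext => n; rewrite /t distrC.
- move=> x y z; apply: d_le => n.
  rewrite (le_trans _ (lerD (le_d n x y) (le_d n y z)))//.
  by rewrite /t -mulrDl ler_wpM2r// ler_distD.
move=> x W; split=> [Wx|[e e0]].
  have /compact_near_coveringP cov := cT.
  have : \forall e \near (0:R)^'+, [set: T] `<=` [set y | d x y < e -> W y].
    apply: cov => y _; have [<-|/t_gt0[n tn]] := pselect (x = y).
      by exists (W, setT) => [|[z e]/= []//]; split => //; exact: filterT.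
    have ty : t n x z @[z --> y] --> t n x y by exact: ct.
    near=> z e => /= dxz; exfalso; move: dxz; apply/negP; rewrite -leNgt.
    apply: le_trans (le_d n x z); apply: (@le_trans _ _ (t n x y / 2)).
      by near: e; apply: nbhs_right_le; rewrite divr_gt0.
    apply: ltW; near: z; apply: (cvgr_gt _ ty); rewrite ltr_pdivrMr//; lra.
  by move=> /near_right0_ex[e e0 eW]; exists e => // y; exact: eW.
move=> eW; apply: filterS eW _.
have [N Ne] : exists N, N.+1%:R^-1 < e / 2 by exact/natSinv_lt/divr_gt0.
have near_t M : \forall y \near x, forall n, (n < M)%N -> t n x y < e / 2.
  elim: M => [|M IH]; first exact: nearW.
  have tM : t M x z @[z --> x] --> t M x x by exact: ct.
  have : \forall y \near x, t M x y < e / 2.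
    by apply: (cvgr_lt _ tM); rewrite txx divr_gt0.
  apply: filterS2 IH => y IH tMy n; rewrite ltnS leq_eqVlt => /orP[/eqP->//|].
  exact: IH.
apply: filterS (near_t N) => y ty /=.
have : d x y <= e / 2; last lra.
apply: d_le => n; have [/ty/ltW//|Nn] := ltnP n N.
rewrite (le_trans (t_le _ _ _))// (le_trans _ (ltW Ne))//.
by rewrite lef_pV2 ?posrE// ler_nat.
Unshelve. all: by end_near. Qed.

(** A network is like a base, except that its members need not be open; this is
    why networks of two subsets can be merged into one of their union. *)
Definition countable_network (X : topologicalType) (A : set X) :=
  exists2 N : set (set X), countable N &
    forall x W, A x -> nbhs x W -> exists2 C, N C & C x /\ C `<=` W.

(** Distinct points lie in two members of the network with disjoint closures,
    by regularity; a Urysohn function for each of these countably many pairs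
    yields a separating sequence. *)
Lemma countable_network_metrizable (T : topologicalType) :
  hausdorff_space T -> compact [set: T] -> countable_network [set: T] ->
  metrizable R T.
Proof.
move=> hT cT [N cN Nnet].
(* Pairs whose closures meet get a dummy constant function. *)
have /choice[f fP] (CD : set T * set T) : exists f : T -> R,
    [/\ continuous f, forall x, 0 <= f x <= 1 &
    closure CD.1 `&` closure CD.2 = set0 ->
    (forall x, CD.1 x -> f x = 0) /\ (forall x, CD.2 x -> f x = 1)].
  have [CD0|nCD0] := pselect (closure CD.1 `&` closure CD.2 = set0); last first.
    exists (cst 0); split => // [|x]; first exact: cst_continuous.
    by rewrite lexx ler01.
  have /(@normal_separatorP R _) nT := compact_normal hT cT.
  have /(@uniform_separatorP _ R)[f [cf f01 f0 f1]] :=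
    nT _ _ (@closed_closure _ CD.1) (@closed_closure _ CD.2) CD0.
  exists f; split => //.
    move=> x; have : `[0, 1]%classic (f x) by apply: f01; exists x.
    by rewrite /= in_itv.
  by move=> _; split=> x /subset_closure Cx; [apply: f0|apply: f1]; exists x.
have /pcard_surjP[e eN] : countable (N `*` N) by exact: countableX.
apply: (@separating_sequence_metrizable T (f \o e)) => //.
- by move=> n; have [] := fP (e n).
- by move=> n; have [] := fP (e n).
move=> x y /eqP xy; move: (hT); rewrite open_hausdorff => /(_ _ _ xy).
case=> -[A B]/= [/set_mem Ax /set_mem By] [oA oB /eqP AB0].
have reg z V : open V -> V z -> exists2 C, N C & C z /\ closure C `<=` V.
  move=> oV Vz; have Vnz : nbhs z V by exact: open_nbhs_nbhs.
  have [V' V'z V'V] := compact_regular hT cT (filterT : nbhs z setT) Vnz.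
  have [C NC [Cz CV']] := Nnet z V' Logic.I V'z.
  by exists C => //; split => //; apply: subset_trans V'V; exact: closureS.
have [C NC [Cx CA]] := reg x A oA Ax.
have [D ND [Dy DB]] := reg y B oB By.
have [n _ en] := eN (C, D) (conj NC ND).
exists n; rewrite /= en; have [_ _ /=] := fP (C, D).
case=> [|-> // -> //]; last by rewrite eq_sym oner_eq0.
by apply/seteqP; split => // z [/CA Az /DB Bz]; rewrite -AB0.
Qed.

(** Finitely many balls of radius [1 / (n + 1)] cover, for each [n]; together
    they form a network. *)
Lemma metrizable_countable_network (T : topologicalType) :
  compact [set: T] -> metrizable R T -> countable_network [set: T].
Proof.
move=> cT [d [d_ge0 _ dC dtri dnbhs]].
pose ball n x := [set y | d x y < n.+1%:R^-1].
have /choice[s sP] n : exists s : seq T,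
    forall y, exists2 x, x \in s & ball n x y.
  apply: compact_finite_subcover => // x.
  by apply/dnbhs; exists n.+1%:R^-1 => //; rewrite invr_gt0.
exists (\bigcup_n [set ball n c | c in [set` s n]]).
  apply: bigcup_countable => // n _; apply/finite_set_countable/finite_image.
  exact: finite_seq.
move=> x W _ /dnbhs[e e0 eW].
have [n ne] : exists n, n.+1%:R^-1 < e / 2 by exact/natSinv_lt/divr_gt0.
have [c cs cx] := sP n x.
exists (ball n c); first by exists n => //; exists c.
split => // y /= cy; apply: eW => /=.
by rewrite (le_lt_trans (dtri x c y))// (dC x) [e]splitr ltrD// (lt_trans _ ne).
Qed.

Lemma countable_network_set_type (X : topologicalType) (A : set X) :
  countable_network [set: A] <-> countable_network A.
Proof.
split=> -[N cN net].
  exists [set \val @` C | C in N].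
    exact: sub_countable (card_image_le _ _) cN.
  move=> x W Ax Wx; pose y : A := exist _ x (mem_set Ax).
  have [C NC [Cy CW]] :=
    net y _ Logic.I (val_continuous (Wx : nbhs (\val y) W)).
  exists (\val @` C); first by exists C.
  by split=> [|_ [z Cz <-]]; [exists y|exact: CW].
exists [set \val @^-1` C | C in N].
  exact: sub_countable (card_image_le _ _) cN.
move=> x W _ /nbhs_set_type[Q Qx QW].
have [C NC [Cx CQ]] := net _ _ (set_mem (valP x)) Qx.
exists (\val @^-1` C); first by exists C.
by split => // y /CQ; exact: QW.
Qed.

Lemma compact_metrizableP (X : topologicalType) (A : set X) :
  hausdorff_space X -> compact A ->
  metrizable R A <-> countable_network A.
Proof.
move=> hX cA; rewrite -countable_network_set_type; split.
  exact/metrizable_countable_network/compact_set_type.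
apply: countable_network_metrizable; first exact: hausdorff_set_type.
exact: compact_set_type.
Qed.

Lemma compact_network_slice_stable (X : topologicalType) :
  slice_stable R (fun A : set X => compact A /\ countable_network A).
Proof.
have [Cc Cu C1 Cs] := @compact_slice_stable X R.
split=> [A [/Cc]//|A B [cA [N cN Nnet]] [cB [M cM Mnet]]|x
  |A f a b [cA [N cN Nnet]] cf].
- split; first exact: Cu.
  exists (\bigcup_(b in [set: bool]) if b then N else M).
    by apply: bigcup_countable => [|[] _ //]; exact: countableP.
  move=> x W [Ax /(Nnet _ _ Ax)|Bx /(Mnet _ _ Bx)] [C NC CW]; exists C => //.
    by exists true.
  by exists false.
- split; first exact: C1.
  exists [set [set x]]; first exact/finite_set_countable/finite_set1.
  by move=> y W -> /nbhs_singleton Wx; exists [set x] => //; split => // z ->.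
apply: slice_exists; split.
  by apply: compact_closedI => //; exact: closed_slice.
by exists N => // x W [Ax _]; exact: Nnet.
Qed.

End Network.

(** * The set-open topology of a slice stable family *)

Section SubbaseNbhs.
Context (X : topologicalType) (R : realType) (lam : set (set X)).

Lemma open_subbase (F : set X) (U : set R) :
  lam F -> open U -> open (@set_open_subbase X R lam (F, U)).
Proof.
move=> lF oU; exists [set (@set_open_subbase X R lam (F, U))].
  move=> W /= ->; exact: (@finI_from1 _ _ _ _ (F, U)).
by rewrite bigcup_set1.
Qed.

(** The form in which the subbase is used: a filter that contains all subbasic
    neighbourhoods of [f] is finer than the neighbourhood filter of [f]. *)
Lemma nbhs_subbase (f : set_open R lam) (G : set_system (set_open R lam))
    (W : set (set_open R lam)) : Filter G ->
  (forall F (U : set R), lam F -> open U ->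
     @set_open_subbase X R lam (F, U) f ->
     G (@set_open_subbase X R lam (F, U))) ->
  nbhs f W -> G W.
Proof.
move=> FG sub; rewrite nbhsE => -[V [[D sD <-] [i Di fi]] VW].
have [E sE iE] := sD i Di.
move: fi; rewrite /isBaseTopological.b/= -iE => fE.
suff : G i.
  apply: filterS => g ig; apply: VW; exists i => //.
rewrite -iE; apply: filter_bigI => j Ej.
have /set_mem[lF oU] := sE j Ej.
by case: j Ej lF oU => F U /= Ej lF oU; apply: sub => //; exact: fE.
Qed.

End SubbaseNbhs.

(** Trades the extended-real supremum for a real bound [s].  If [F] is empty the
    supremum is [-oo], and [e - 1] serves as a bound. *)
Lemma sup_ballP (X : topologicalType) (R : realType) (F : set X)
    (f g : continuousType X R) (e : R) :
  sup_ball F f e g <->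
  exists2 s, s < e & forall x, F x -> `|f x - g x| <= s.
Proof.
split=> [|[s se Fs]]; last first.
  apply: (@le_lt_trans _ _ s%:E); last by rewrite lte_fin.
  by apply: ge_ereal_sup => _ [x Fx <-]; rewrite lee_fin; exact: Fs.
rewrite /sup_ball/=; set S := ereal_sup _ => Se.
have ubS x : F x -> (`|f x - g x|%:E <= S)%E.
  by move=> Fx; apply: ereal_sup_ubound; exists x.
case: S Se ubS => [s|//|_ ubS].
  by rewrite lte_fin => se ubS; exists s => // x /ubS; rewrite lee_fin.
by exists (e - 1) => [|x /ubS//]; rewrite ltrBlDr ltrDl.
Qed.

Section LocallyUniform.
Context (X : topologicalType) (R : realType) (P : set X -> Prop).
Hypothesis stableP : slice_stable R P.
Local Notation CX := (continuousType X R).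

Let lam : set (set X) := [set F | F !=set0 /\ P F].

Let lamC F : lam F -> C_compact R F.
Proof. by have [+ _ _ _] := stableP => PC [_ /PC]. Qed.

Let lamU F G : lam F -> lam G -> lam (F `|` G).
Proof.
have [_ PU _ _] := stableP.
by move=> [[x Fx] PF] [_ PG]; split; [exists x; left|exact: PU].
Qed.

Let lam1 x : lam [set x].
Proof. by have [_ _ P1 _] := stableP; split; [exists x|exact: P1]. Qed.

Let lamP F (f : X -> R) (a b : R) : lam F -> continuous f ->
  exists G, [/\ F `&` f @^-1` `]a, b[ `<=` G, G `<=` f @^-1` `[a, b] &
                G = set0 \/ lam G].
Proof.
have [_ _ _ Ps] := stableP => -[_ PF] cf.
have [G [FG Gf PG]] := Ps F f a b PF cf; exists G; split => //.
by have [->|/set0P G0] := eqVneq G set0; [left|right].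
Qed.

(** Compactness of [f(F)] gives one radius that works at all of its points. *)
Lemma sup_ball_sub_subbase (F : set X) (U : set R) (f : CX) :
  lam F -> open U -> f @` F `<=` U ->
  exists2 e : R, 0 < e & forall g, sup_ball F f e g -> g @` F `<=` U.
Proof.
move=> lF oU fFU.
have /compact_near_coveringP cK := lamC lF (@cts_fun _ _ f).
have : \forall e \near (0:R)^'+, f @` F `<=` [set t | ball t e `<=` U].
  apply: cK => _ [x Fx <-].
  have /nbhs_ballP[r /= r0 rU] : nbhs (f x) U.
    by apply: open_nbhs_nbhs; split => //; apply: fFU; exists x.
  near=> t e => /= s ts; apply: rU.
  rewrite [r]splitr; apply: (@ball_triangle _ _ t).
    by near: t; apply: nbhsx_ballx; exact: divr_gt0.
  apply: le_ball ts; near: e; apply: nbhs_right_le; exact: divr_gt0.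
move=> /near_right0_ex[e e0 eU]; exists e => // g /sup_ballP[s se gs].
move=> _ [x Fx <-].
apply: (eU (f x)); first by exists x.
by apply: le_lt_trans se; exact: gs.
Unshelve. all: by end_near. Qed.

(** The finite cover of [f(F)] by short intervals is hidden in the near-covering
    form of compactness: it is enough that for each [t] all [g] close to [f]
    satisfy the estimate at all points [x] of [F] with [f x] close to [t], and
    one subbasic neighbourhood of [f] ensures this. *)
Lemma nbhs_sup_ball (F : set X) (f : CX) (e : R) :
  lam F -> 0 < e -> nbhs (f : set_open R lam) (sup_ball F f e).
Proof.
(* The estimate reached below is 3 * d, so any d < e / 3 would do. *)
move=> lF e0; pose d := e / 4.
have d0 : 0 < d by exact: divr_gt0.
have /compact_near_coveringP cK := lamC lF (@cts_fun _ _ f).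
pose close (g : set_open R lam) (t : R) := forall x, F x -> f x = t ->
  `|f x - (g : CX) x| <= 3 * d.
have : \forall g \near nbhs (f : set_open R lam), f @` F `<=` close g.
  apply: cK => t _.
  have [G [FG GF lG]] := lamP (t - d) (t + d) lF (@cts_fun _ _ f).
  have nG : \forall g \near nbhs (f : set_open R lam),
      (g : CX) @` G `<=` `](t - 2 * d), (t + 2 * d)[.
    case: lG => [->|lG]; first by apply: nearW => g; rewrite image_set0.
    apply: (@open_nbhs_nbhs (set_open R lam)); split.
      by apply: (@open_subbase X R lam G) => //; exact: itv_open.
    move=> _ /= [y Gy <-]; have := GF y Gy; rewrite /= !in_itv/=; lra.
  near=> s g => x Fx fxs.
  have fx : `](t - d), (t + d)[%classic (f x).
    rewrite /= fxs in_itv/= -ltr_distl distrC; near: s; exact: nbhsx_ballx.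
  have gx : `](t - 2 * d), (t + 2 * d)[%classic ((g : CX) x).
    by apply: (near nG g) => //; exists x => //; exact: FG.
  move: fx gx; rewrite /= !in_itv/= => fx gx; rewrite ler_distl; lra.
apply: filterS => g gK; apply/sup_ballP.
exists (3 * d); first by rewrite /d; lra.
by move=> x Fx; apply: (gK (f x)) => //; exists x.
Unshelve. all: by end_near. Qed.

(** The case [W = setT] makes this a filter also when [lam] is empty, that is,
    when [X] is empty. *)
Definition sup_ball_nbhs (f : CX) : set_system CX :=
  [set W | W = setT \/
    exists F (e : R), [/\ lam F, 0 < e & sup_ball F f e `<=` W]].

Lemma sup_ballS (F G : set X) (f : CX) (d e : R) :
  F `<=` G -> d <= e -> sup_ball G f d `<=` sup_ball F f e.
Proof.
move=> FG de g /sup_ballP[s sd gs]; apply/sup_ballP; exists s.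
  exact: lt_le_trans de.
by move=> x /FG; exact: gs.
Qed.

Lemma sup_ball_nbhs_filter f : Filter (sup_ball_nbhs f).
Proof.
split; first by left.
- move=> V W [->|[F [d [lF d0 FV]]]]; first by rewrite setTI.
  case=> [->|[G [e [lG e0 GW]]]]; first by rewrite setIT; right; exists F, d.
  right; exists (F `|` G), (Num.min d e); split => [||g Fg].
  + exact: lamU.
  + by rewrite lt_min d0.
  + by split; [apply: FV|apply: GW]; apply: sup_ballS Fg => //;
      rewrite ge_min lexx ?orbT.
- move=> V W VW [VT|[F [e [lF e0 FV]]]]; first by left; rewrite -subTset -VT.
  by right; exists F, e; split => // g /FV/VW.
Qed.

Lemma nbhs_set_openE (f : set_open R lam) : nbhs f = sup_ball_nbhs f.
Proof.
apply/seteqP; split => W.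
  apply: (@nbhs_subbase X R lam f _ W (sup_ball_nbhs_filter f)) => F U lF oU fU.
  have [e e0 eU] := sup_ball_sub_subbase lF oU fU.
  by right; exists F, e; split => // g /eU.
case=> [->|[F [e [lF e0 eW]]]]; first exact: filterT.
exact: filterS eW (nbhs_sup_ball _ lF e0).
Qed.

Lemma set_open_uniform_openE :
  [set W : set (set_open R lam) | open W] = uniform_open lam.
Proof.
apply/seteqP; split => W /=.
  rewrite openE => oW; have [->|WT] := pselect (W = setT); first by left.
  by right => f /oW; rewrite /interior nbhs_set_openE => -[].
case=> [->|oW]; first exact: openT.
rewrite openE => f /oW[F [e [lF e0 eW]]].
by rewrite /interior nbhs_set_openE; right; exists F, e.
Qed.

Lemma open_sup_ball (F : set X) (f : CX) (e : R) : lam F ->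
  open (sup_ball F f e : set (set_open R lam)).
Proof.
move=> lF; rewrite openE => g /sup_ballP[s se gs].
rewrite /interior nbhs_set_openE; right; exists F, (e - s).
split => [//||h /sup_ballP[r re hr]]; first by rewrite subr_gt0.
apply/sup_ballP; exists (s + r) => [|x Fx]; first by rewrite addrC -ltrBrDr.
by rewrite (le_trans (ler_distD (g x) _ _))// lerD ?gs ?hr.
Qed.

Lemma set_open_hausdorff : hausdorff_space (set_open R lam).
Proof.
rewrite open_hausdorff => f g fg.
have [x fgx] : exists x, (f : CX) x != (g : CX) x.
  apply: contrapT => /forallNP fg0; case/eqP: fg; apply/continuousEP => x.
  by apply/eqP; apply: contrapT => /negP; exact: fg0.
have := @order_hausdorff _ R; rewrite open_hausdorff => /(_ _ _ fgx).
case=> -[A B]/= [/set_mem Afx /set_mem Bgx] [oA oB AB].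
exists (@set_open_subbase X R lam ([set x], A),
        @set_open_subbase X R lam ([set x], B)) => /=.
  by split; apply/mem_set => _ [_ -> <-].
split; [exact: open_subbase|exact: open_subbase|].
apply/eqP/seteqP; split => // h [hA hB].
have /seteqP[+ _] := eqP AB; apply; split; [apply: hA|apply: hB]; by exists x.
Qed.

Lemma set_open_add_continuous :
  continuous (fun z : set_open R lam * set_open R lam => z.1 + z.2).
Proof.
move=> [f g] W; rewrite nbhs_set_openE => -[->|[F [e [lF e0 eW]]]].
  exact: filterT.
have e2 : 0 < e / 2 by exact: divr_gt0.
exists (sup_ball F f (e / 2), sup_ball F g (e / 2)).
  by split; exact: nbhs_sup_ball.
move=> [h k]/= [/sup_ballP[s se hs] /sup_ballP[r re kr]]; apply: eW.
apply/sup_ballP; exists (s + r) => [|x Fx]; first lra.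
have -> : ((f : CX) + g) x - ((h : CX) + k) x =
    ((f : CX) x - (h : CX) x) + ((g : CX) x - (k : CX) x).
  by rewrite addrACA -opprD.
by rewrite (le_trans (ler_normD _ _))// lerD ?hs ?kr.
Qed.

(** [a f - b g = (a - b) f + b (f - g)], where [f] is bounded on [F] because
    [f(F)] is compact, and [|b| <= |a| + 1] for [b] close to [a]; the radii [d]
    and [r] make each of the two terms at most [e / 4]. *)
Lemma set_open_scale_continuous :
  continuous (fun z : R^o * set_open R lam => z.1 *: z.2).
Proof.
move=> [a f] W; rewrite nbhs_set_openE => -[->|[F [e [lF e0 eW]]]].
  exact: filterT.
have [M [M0 fM]] : exists M, 0 < M /\ forall x, F x -> `|(f : CX) x| <= M.
  have [N [_ /(_ (`|N| + 1))fN]] := compact_bounded (lamC lF (@cts_fun _ _ f)).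
  exists (`|N| + 1); split => [|x Fx]; first by rewrite ltr_wpDl.
  apply: fN; last by exists x.
  by rewrite (le_lt_trans (ler_norm _))// ltrDl.
have a1 : 0 < `|a| + 1 by rewrite ltr_wpDl.
pose d := Num.min 1 (e / (4 * M)).
pose r := e / (4 * (`|a| + 1)).
have r0 : 0 < r by rewrite divr_gt0// mulr_gt0.
exists (ball (a : R^o) d, sup_ball F f r).
  split; last exact: nbhs_sup_ball.
  by apply: nbhsx_ballx; rewrite lt_min ltr01 divr_gt0// mulr_gt0.
move=> [b g]/= [abd /sup_ballP[s sr gs]]; apply: eW.
have [ab1 abM] : `|a - b| < 1 /\ `|a - b| < e / (4 * M).
  by apply/andP; rewrite -lt_min.
apply/sup_ballP; exists (e / 2) => [|x Fx]; first lra.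
have -> : (a *: (f : CX)) x - (b *: (g : CX)) x =
    (a - b) * (f : CX) x + b * ((f : CX) x - (g : CX) x).
  by rewrite mulrBl mulrBr addrA subrK.
have ba : `|b| <= `|a| + 1.
  rewrite -[b](subrK a) addrC (le_trans (ler_normD _ _))// lerD2l distrC.
  exact: ltW.
rewrite (le_trans (ler_normD _ _))// !normrM [e in e / 2]splitr mulrDl.
have eM : e / 4 = e / (4 * M) * M by field; rewrite gt_eqF.
have ea : e / 4 = (`|a| + 1) * r by rewrite /r; field; rewrite gt_eqF.
have -> : e / 2 / 2 = e / 4 by lra.
apply: lerD; [rewrite eM|rewrite ea]; apply: ler_pM => //.
- exact: ltW.
- exact: fM.
- by rewrite (le_trans (gs _ Fx))// ltW.
Qed.

Lemma sup_ball_convex (F : set X) (f : set_open R lam) (e : R) :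
  convex_set (sup_ball F f e : set (convex_lmodType (set_open R lam))).
Proof.
apply/convex_setW => g h /set_mem/sup_ballP[s se gs].
move=> /set_mem/sup_ballP[r re hr] k k0 k1.
apply/mem_set/sup_ballP; exists (Num.max s r); first by rewrite gt_max se.
move=> x Fx; set t := k%:num in k0 k1 *.
have -> : (f : CX) x - (g <| k |> h : CX) x =
   t * ((f : CX) x - (g : CX) x) +
   (1 - t) * ((f : CX) x - (h : CX) x).
  rewrite [(g <| k |> h : CX) x](_ : _ = t * (g : CX) x +
    (1 - t) * (h : CX) x)//.
  ring.
have t1 : 0 <= 1 - t by rewrite subr_ge0 ltW.
apply: le_trans (ler_normD _ _) _.
rewrite !normrM (ger0_norm (ltW k0)) (ger0_norm t1).
have -> : Num.max s r = t * Num.max s r + (1 - t) * Num.max s r by ring.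
by apply: lerD; apply: ler_wpM2l; rewrite ?(ltW k0)// le_max ?gs ?hr ?orbT.
Qed.

Lemma set_open_locally_convex : locally_convex_tvs (set_open R lam).
Proof.
split; [exact: set_open_add_continuous|exact: set_open_scale_continuous|].
exists [set B : set (set_open R lam) |
  open B /\ convex_set (B : set (convex_lmodType (set_open R lam)))].
  by move=> B /set_mem[].
split=> [B []//|f W]; rewrite nbhs_set_openE => -[->|[F [e [lF e0 eW]]]].
  by exists setT => //; split=> //; split; [exact: openT|move=> *; rewrite inE].
exists (sup_ball F f e) => //; split; last first.
  apply/sup_ballP; exists 0 => // x _; by rewrite subrr normr0.
split; [exact: open_sup_ball|exact: sup_ball_convex].
Qed.

Lemma set_open_slice_stable :
  [set W : set (set_open R lam) | open W] = uniform_open lam /\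
  hausdorff_space (set_open R lam) /\
  locally_convex_tvs (set_open R lam).
Proof.
split; first exact: set_open_uniform_openE.
by split; [exact: set_open_hausdorff|exact: set_open_locally_convex].
Qed.

End LocallyUniform.

(** * The seven families *)

Lemma tychonoff_hausdorff (X : topologicalType) (R : realType) :
  tychonoff_space X -> hausdorff_space X.
Proof.
move=> [/accessible_closed_set1 aX crX] p q pq; apply: contrapT => pNq.
have /(@uniform_separatorP _ R)[f [cf _ f0 f1]] := crX p [set q] (aX q) pNq.
have fp : f p = 0 by apply: f0; exists p.
have fq : f q = 1 by apply: f1; exists q.
have [| |z [/= fz1 fz2]] := pq [set z | f z < 1 / 2] [set z | 1 / 2 < f z].
- by apply: (cvgr_lt _ (cf p)); rewrite fp; lra.
- by apply: (cvgr_gt _ (cf q)); rewrite fq; lra.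
by have := lt_trans fz1 fz2; rewrite ltxx.
Qed.

Lemma MC_familyE (X : topologicalType) (R : realType) : hausdorff_space X ->
  MC_family R X =
  [set A | A !=set0 /\ (compact A /\ countable_network A)].
Proof.
move=> hX; apply/seteqP; split=> A.
  by move=> [A0 cA /(compact_metrizableP R hX cA)].
by move=> [A0 [cA /(compact_metrizableP R hX cA)]].
Qed.

Theorem theorem4p1 (R : realType) (X : topologicalType)
    (tychonoffX : tychonoff_space X) (lam : set (set X))
    (lamE : lam = F_family X \/ lam = MC_family R X \/ lam = K_family X \/
            lam = SC_family X \/ lam = CC_family X \/ lam = PS_family R X \/
            lam = RC_family R X) :
  [set W : set (set_open R lam) | open W] = uniform_open lam /\
  hausdorff_space (set_open R lam) /\
  locally_convex_tvs (set_open R lam).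
Proof.
have hX := tychonoff_hausdorff R tychonoffX; have [_ crX] := tychonoffX.
case: lamE => [|[|[|[|[|[|]]]]]] ->.
- exact/set_open_slice_stable/finite_set_slice_stable.
- rewrite (MC_familyE R hX).
  exact/set_open_slice_stable/compact_network_slice_stable.
- exact/set_open_slice_stable/compact_slice_stable.
- exact/set_open_slice_stable/sequentially_compact_slice_stable.
- exact/set_open_slice_stable/countably_compact_slice_stable.
- exact/set_open_slice_stable/pseudocompact_slice_stable.
- exact/set_open_slice_stable/C_compact_slice_stable.
Qed.
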